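(* As sequences indexed by $n\geq1$, $$\mathrm{orb}=r+\mathrm{orb}_1\ast\mathbf{1},\qquad 2\,\mathrm{orb}_1=\mathrm{A113788}-r\ast\mu,\qquad \mathrm{orb}_2=r\ast\mu+\mathrm{orb}_1\ast e_2.$$ That is, for every $n\geq1$: $\mathrm{orb}(n)=r(n)+\sum_{d\mid n}\mathrm{orb}_1(d)$; $2\,\mathrm{orb}_1(n)=\frac1n\sum_{d\mid n}p(d)\mu(n/d)-\sum_{d\mid n}r(d)\mu(n/d)$; and $\mathrm{orb}_2(n)=\sum_{d\mid n}r(d)\mu(n/d)+[2\mid n]\,\mathrm{orb}_1(n/2)$.
   Context: For $n\geq1$ let $V_n=\{v_0,\dots,v_{n-1}\}$, indices modulo $n$. The dihedral group $D_{2n}$ generated by $\sigma(v_i)=v_{i+1}$ and $\tau(v_i)=v_{n-i}$ acts on subsets of $V_n$ elementwise. Let $\mathbf{X}_n$ be the family of subsets $X\subseteq V_n$ such that (a) there is no $i\in\mathbb{Z}_n$ with $v_i,v_{i+1}\in X$, and (b) for every $i\in\mathbb{Z}_n$ at least one of $v_i,v_{i+1},v_{i+2}$ lies in $X$ (for $n\geq 3$: the maximal independent sets of the cycle graph $C_n$). $\mathrm{orb}(n)$ is the number of $D_{2n}$-orbits of $\mathbf{X}_n$, and for $d\mid 2n$, $\mathrm{orb}_d(n)$ is the number of these orbits of cardinality $2n/d$ (equivalently, whose elements have stabilizer of order $d$). Perrin: $p(1)=0,p(2)=2,p(3)=3$, $p(n)=p(n-2)+p(n-3)$ ($n\geq4$).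 Padovan: $q(1)=0,q(2)=1,q(3)=1$, $q(n)=q(n-2)+q(n-3)$ ($n\geq4$); $r(2k-1)=q(k)$, $r(2k)=q(k+2)$. The Dirichlet convolution is $(f\ast g)(n)=\sum_{d\mid n}f(d)g(n/d)$; $\mu$ is the Möbius function; $\mathbf{1}(n)=1$; $e_2(n)=1$ if $n=2$ and $0$ otherwise; $\mathrm{A113788}(n)=\frac1n(p\ast\mu)(n)$. *)

(* Defs.v *)
From mathcomp Require Import all_boot all_order all_algebra.
Set Implicit Arguments. Unset Strict Implicit. Unset Printing Implicit Defensive.
Import GRing.Theory Num.Theory.

(* V_n is represented by 'I_n : v_i is the ordinal with value i. *)

Definition mem_mod (n : nat) (X : {set 'I_n}) (i : nat) : bool :=
  [exists j : 'I_n, (val j == i %% n) && (j \in X)].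

Definition goodX (n : nat) (X : {set 'I_n}) : bool :=
  [forall i : 'I_n, ~~ (mem_mod X i && mem_mod X i.+1)] &&
  [forall i : 'I_n, [|| mem_mod X i, mem_mod X i.+1 | mem_mod X i.+2]].

Definition Xfam (n : nat) : {set {set 'I_n}} := [set X | goodX X].

(* Elementwise action of the group element sigma^k tau^b :
   v_i |-> v_((if b then n - i else i) + k). *)
Definition dact (n : nat) (k : nat) (b : bool) (X : {set 'I_n}) : {set 'I_n} :=
  [set j : 'I_n | [exists i in X,
     val j == ((if b then n - val i else val i) + k) %% n]].

(* D_{2n}-orbit of X: images under the 2n elements sigma^k tau^b, k < n. *)
Definition dorbit (n : nat) (X : {set 'I_n}) : {set {set 'I_n}} :=
  [set dact (val kb.1) kb.2 X | kb : 'I_n * bool].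

Definition orbits (n : nat) : {set {set {set 'I_n}}} :=
  [set dorbit X | X in Xfam n].

Definition orb (n : nat) : nat := #|orbits n|.

Definition orb_d (d n : nat) : nat :=
  #|[set O in orbits n | #|O| * d == 2 * n]|.

(* Perrin: p 1 = 0, p 2 = 2, p 3 = 3 (p 0 := 3 makes the recurrence
   p (n+3) = p (n+1) + p n hold from n+3 = 3 on). *)
Fixpoint perrin (n : nat) : nat :=
  match n with
  | 0 => 3
  | 1 => 0
  | 2 => 2
  | (m.+1 as k).+2 => perrin k + perrin m
  end.

Fixpoint padovan (n : nat) : nat :=
  match n with
  | 0 => 1
  | 1 => 0
  | 2 => 1
  | (m.+1 as k).+2 => padovan k + padovan m
  end.

Definition rr (n : nat) : nat :=
  if odd n then padovan n.+1./2 else padovan (n./2 + 2).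

Definition moebius (n : nat) : int :=
  if n == 0 then 0%R
  else if all (fun p => logn p n == 1) (primes n)
       then ((-1) ^+ size (primes n))%R else 0%R.

(* Main.v *)
Require Import Defs.
From mathcomp Require Import all_boot all_order all_algebra.
From mathcomp Require Import zify ring.
Set Implicit Arguments. Unset Strict Implicit. Unset Printing Implicit Defensive.
Import Order.TTheory GRing.Theory Num.Theory.
Local Open Scope ring_scope.

(** View a set in X_n as an n-periodic function f on the integers;
    membership in X_n, the minimal period and the reflections of f then make
    sense without reference to n, so that the elements of X_n of minimal period
    d | n correspond to those of X_d.  The orbit of f has d elements if f has a
    reflection f (k - z) = f z, and 2d elements otherwise.  Writing w(d, b) for
    the number of elements of X_d of minimal period d with (b) or without
    reflection, this gives
      orb(n) = sum_(d | n) (w(d, -) / 2d + w(d, +) / d),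
      orb_1(n) = w(n, -) / 2n,   orb_2(n) = w(n, +) / n + [2 | n] orb_1(n/2).
    An element of X_n of minimal period d which has a reflection has n/d of
    them, so n sum_(d | n) w(d, +) / d counts the pairs of an element of X_n
    and one of its reflections.  Moebius inversion reduces the theorem to
      sum_(d | n) (w(d, -) + w(d, +)) = p(n),  sum_(d | n) w(d, +) / d = r(n).
    Both are walk counts on the graph whose states are two consecutive values
    of f: closed walks of length n for p(n), and walks across half a period
    between the two symmetry axes for r(n). *)

(** * Sets as periodic functions *)

(* Indices live in the integers so that reflections [k - z] need no truncated
   subtraction, and so that sets over different ['I_n] can be compared. *)
Definition ind {n : nat} (X : {set 'I_n}) (z : int) : bool :=
  mem_mod X `|(z %% n)%Z|%N.

Section Indicator.
Variables (n : nat) (n_gt0 : (0 < n)%N).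
Implicit Types X Y : {set 'I_n}.

Lemma ind_ord X (i : 'I_n) : ind X (i : nat) = (i \in X).
Proof.
rewrite /ind /mem_mod modz_nat absz_nat modn_mod modn_small //.
apply/existsP/idP => [[j /andP[/eqP/val_inj-> //]]|iX].
by exists i; rewrite eqxx.
Qed.

Lemma ind_mod X z : ind X (z %% n)%Z = ind X z.
Proof. by rewrite /ind modz_mod. Qed.

Lemma ind_congr X x y : (x = y %[mod n])%Z -> ind X x = ind X y.
Proof. by rewrite -(ind_mod X x) => ->; rewrite ind_mod. Qed.

Lemma ind_addn X z : ind X (z + n%:Z) = ind X z.
Proof. by apply: ind_congr; rewrite modzDr. Qed.

Lemma ord_of_int (z : int) : exists i : 'I_n, (z %% n)%Z = (i : nat).
Proof.
have lt_n : (`|(z %% n)%Z| < n)%N by lia.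
by exists (Ordinal lt_n) => /=; lia.
Qed.

Lemma ind_inj X Y : ind X =1 ind Y -> X = Y.
Proof. by move=> eXY; apply/setP => i; rewrite -!ind_ord eXY. Qed.

Lemma mem_modE X (i : nat) : mem_mod X i = ind X i.
Proof. by rewrite /ind /mem_mod modz_nat absz_nat modn_mod. Qed.

Definition set_of_fun (f : int -> bool) : {set 'I_n} := [set j : 'I_n | f (j : nat)].

Lemma ind_set_of_fun f : (forall z, f (z + n%:Z) = f z) ->
  ind (set_of_fun f) =1 f.
Proof.
move=> per z.
have perM (k : nat) x : f (x + k%:Z * n%:Z) = f x.
  by elim: k => [|k IH]; [rewrite mul0r addr0 | rewrite -[RHS]IH -[RHS]per; congr f; lia].
have perZ (k : int) x : f (x + k * n%:Z) = f x.
  case: k => k; first exact: perM.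
  by rewrite -[LHS](perM k.+1); congr f; rewrite NegzE; ring.
rewrite -ind_mod; have [i zi] := ord_of_int z.
by rewrite zi ind_ord inE -zi {2}(divz_eq z n) addrC perZ.
Qed.

(** Both adjacent pairs are tested, so that the condition is invariant under reversal, as
    reflections require. *)
Definition okc (a b c : bool) := [&& ~~ (a && b), ~~ (b && c) & [|| a, b | c]].

Lemma okc_sym a b c : okc a b c = okc c b a.
Proof. by case: a; case: b; case: c. Qed.

Lemma XfamP X :
  reflect (forall z, okc (ind X (z - 1)) (ind X z) (ind X (z + 1))) (X \in Xfam n).
Proof.
rewrite inE; apply: (iffP andP) => [[/forallP gA /forallP gB] z|ok].
  have memA x : ~~ (ind X x && ind X (x + 1)).
    rewrite -ind_mod -[ind X (x + 1)]ind_mod -modzDml.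
    by have [i ->] := ord_of_int x; move: (gA i); rewrite !mem_modE ind_mod -addn1 PoszD.
  have memB x : [|| ind X x, ind X (x + 1) | ind X (x + 2)].
    rewrite -ind_mod -[ind X (x + 1)]ind_mod -[ind X (x + 2)]ind_mod -modzDml -[((x + 2) %% n)%Z]modzDml.
    have [i ->] := ord_of_int x; move: (gB i).
    by rewrite !mem_modE !ind_mod -addn2 -addn1 !PoszD.
  move: (memA (z - 1)) (memA z) (memB (z - 1)).
  by rewrite subrK -addrA /okc => -> -> /=.
split; apply/forallP => i.
  by have /and3P[_] := ok (i : nat); rewrite !mem_modE -addn1 PoszD.
have /and3P[_ _] := ok ((i : nat)%:Z + 1).
by rewrite addrK -addrA !mem_modE -addn2 -addn1 !PoszD.
Qed.

Lemma ind_dact (k : nat) (b : bool) X z :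
  ind (dact k b X) z = ind X (if b then k%:Z - z else z - k%:Z).
Proof.
rewrite -ind_mod; have [j zj] := ord_of_int z.
rewrite zj ind_ord inE.
apply/exists_inP/idP => [[i iX /eqP ej]|].
  rewrite -ind_ord in iX; suff -> : ind X (if b then k%:Z - z else z - k%:Z) = ind X (i : nat) by []; apply: ind_congr.
  move: zj; rewrite ej; case: b {ej}; rewrite -?modz_nat => /eqP zj; apply/eqP; move: zj;
    rewrite !eqz_mod_dvd => /dvdzP[q zj]; apply/dvdzP.
    (* The reflection changes the sign of the quotient, and [- 1] absorbs the [n] in [n - val i]. *)
    exists (- q - 1); rewrite mulrBl mulNr -zj; have := ltn_ord i => /=; lia.
  exists q; rewrite -zj /=; lia.
rewrite -ind_mod; set y := if b then _ else _ => iX.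
have [i yi] := ord_of_int y.
exists i; first by rewrite -ind_ord -yi.
rewrite -eqz_nat -zj -modz_nat eqz_mod_dvd.
have: (n %| y - (i : nat)%:Z)%Z by rewrite -eqz_mod_dvd yi modz_small //; have := ltn_ord i; lia.
rewrite /y; case: (b) => /dvdzP[q e]; apply/dvdzP.
  exists (-q - 1); rewrite mulrBl mulNr -e; have := ltn_ord i => /=; lia.
exists q; rewrite -e /=; lia.
Qed.

End Indicator.

(** * Periods, reflections and orbits *)

Definition perb {n : nat} (X : {set 'I_n}) (d : int) : bool :=
  [forall i : 'I_n, ind X ((i : nat)%:Z + d) == ind X (i : nat)].

Definition reflb {n : nat} (X : {set 'I_n}) (k : int) : bool :=
  [forall i : 'I_n, ind X (k - (i : nat)%:Z) == ind X (i : nat)].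

(** For positive [n] the search succeeds because [n] is a period; the successor turns a position in
    [iota 1 n] into the period standing there. *)
Definition minper {n : nat} (X : {set 'I_n}) : nat :=
  (find (fun d : nat => perb X d) (iota 1 n)).+1.

Definition achiral {n : nat} (X : {set 'I_n}) : bool :=
  [exists k : 'I_n, reflb X (k : nat)].

Section Periods.
Variables (n : nat) (n_gt0 : (0 < n)%N).
Implicit Types X Y : {set 'I_n}.

Lemma perP X d : reflect (forall z, ind X (z + d) = ind X z) (perb X d).
Proof.
apply: (iffP forallP) => [h z|h i]; last by rewrite h.
rewrite -[LHS]ind_mod -modzDml [LHS]ind_mod -[RHS]ind_mod.
by have [i ->] := ord_of_int n_gt0 z; exact: (eqP (h i)).
Qed.

Lemma reflP X k : reflect (forall z, ind X (k - z) = ind X z) (reflb X k).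
Proof.
apply: (iffP forallP) => [h z|h i]; last by rewrite h.
rewrite -[LHS]ind_mod -modzDmr -modzNm modzDmr [LHS]ind_mod -[RHS]ind_mod.
by have [i ->] := ord_of_int n_gt0 z; exact: (eqP (h i)).
Qed.

Lemma perbD X a b : perb X a -> perb X b -> perb X (a + b).
Proof. by move=> /perP ha /perP hb; apply/perP => z; rewrite addrA hb ha. Qed.

Lemma perbN X a : perb X a -> perb X (- a).
Proof. by move=> /perP ha; apply/perP => z; rewrite -{2}(subrK a z) ha. Qed.

Lemma perbM X (q a : int) : perb X a -> perb X (q * a).
Proof.
move=> ha; have nat_mul (k : nat) : perb X (k%:Z * a).
  elim: k => [|k IH]; first by apply/perP => z; rewrite mul0r addr0.
  by rewrite intS mulrDl mul1r perbD.
by case: q => k; rewrite ?NegzE ?mulNr ?perbN.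
Qed.

Lemma perb_n X : perb X n.
Proof. by apply/perP => z; rewrite ind_addn. Qed.

(** The periods form a subgroup of the integers: the remainder of a period modulo [minper X] is
    again a period, and minimality makes it zero. *)
Lemma perbE X k : perb X k = (minper X %| k)%Z.
Proof.
have hasp : has (fun d : nat => perb X d) (iota 1 n).
  by apply/hasP; exists n; rewrite ?perb_n // mem_iota; lia.
have find_lt : (find (fun d : nat => perb X d) (iota 1 n) < n)%N.
  by move: hasp; rewrite has_find size_iota.
have per_mp : perb X (minper X).
  by have := nth_find 0%N hasp; rewrite nth_iota ?add1n.
apply/idP/dvdzP => [perk|[q ->]]; last exact: perbM.
have perr : perb X (k %% minper X)%Z.
  have -> : (k %% minper X)%Z = k + - ((k %/ minper X)%Z * minper X) by rewrite /modz.
  by rewrite perbD // perbN // perbM.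
exists (k %/ minper X)%Z; rewrite {1}(divz_eq k (minper X)).
have [r_lt r_ge0] : (k %% minper X)%Z < minper X /\ 0 <= (k %% minper X)%Z.
  by split; [rewrite ltz_pmod | rewrite modz_ge0].
case: (k %% minper X)%Z perr r_lt r_ge0 => // -[|r] perr r_lt _; first by rewrite addr0.
have r_lt' : (r < find (fun d : nat => perb X d) (iota 1 n))%N by move: r_lt; rewrite /minper; lia.
have := before_find 0%N r_lt'.
by rewrite nth_iota ?add1n ?perr // (ltn_trans r_lt').
Qed.

Lemma minper_dvd X : (minper X %| n)%N.
Proof. by have := perb_n X; rewrite perbE. Qed.

Lemma achiralP X : reflect (exists k : int, reflb X k) (achiral X).
Proof.
apply: (iffP existsP) => [[k hk]|[k /reflP hk]]; first by exists (k : nat).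
have [i ki] := ord_of_int n_gt0 k; exists i; apply/reflP => z.
by rewrite -[RHS]hk -ki; apply: ind_congr; rewrite modzDml.
Qed.

(** Two reflections compose to the translation by the difference of their parameters, so the
    reflections of [X], if any, form a coset of the group of periods. *)
Lemma reflb_sub X k l : reflb X k -> reflb X l = perb X (l - k).
Proof.
move=> /reflP hk; apply/reflP/perP => h z.
  by rewrite -[RHS]hk -[RHS]h; congr ind; ring.
by rewrite -[RHS]hk -[RHS]h; congr ind; ring.
Qed.

Lemma dact_same_eq X b (k l : nat) :
  (dact k b X == dact l b X) = (minper X %| k%:Z - l%:Z)%Z.
Proof.
rewrite -perbE; apply/eqP/perP => [e z|h].
  case: b e => e; have eI := congr1 ind e.
    have := congr1 (fun f => f (l%:Z - z)) eI; rewrite !ind_dact //= subKr => <-.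
    by congr ind; ring.
  have := congr1 (fun f => f (z + k%:Z)) eI; rewrite !ind_dact //= addrK => ->.
  by congr ind; ring.
apply: ind_inj => z; rewrite !ind_dact //; case: b.
  by rewrite -[RHS]h; congr ind; ring.
by rewrite -[LHS]h; congr ind; ring.
Qed.

Lemma dact_diff_eq X (k l : nat) :
  (dact k false X == dact l true X) = reflb X (l%:Z - k%:Z).
Proof.
apply/eqP/reflP => [e z|h].
  have := congr1 (fun Y => ind Y (z + k%:Z)) e; rewrite !ind_dact //= addrK => ->.
  by congr ind; ring.
by apply: ind_inj => z; rewrite !ind_dact //= -h; congr ind; ring.
Qed.

Definition rotations X (b : bool) : {set {set 'I_n}} :=
  [set dact (k : nat) b X | k : 'I_n].

Lemma mem_rotations X b (k : int) Y :
  ind Y =1 (fun z => ind X (if b then k - z else z - k)) -> Y \in rotations X b.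
Proof.
move=> eY; have [i ki] := ord_of_int n_gt0 k.
apply/imsetP; exists i => //; apply: ind_inj => z; rewrite eY ind_dact // -ki.
by case: b eY => eY; apply: ind_congr; rewrite ?modzDml // -[in RHS]modzDmr modzNm modzDmr.
Qed.

Lemma card_rotations X b : #|rotations X b| = minper X.
Proof.
have le_n : (minper X <= n)%N by rewrite dvdn_leq ?minper_dvd.
have -> : rotations X b = [set dact (k : nat) b X | k : 'I_(minper X)].
  apply/setP => Y; apply/imsetP/imsetP => -[k _ ->]; last by exists (widen_ord le_n k).
  have k'_lt : (k %% minper X < minper X)%N by rewrite ltn_mod.
  exists (Ordinal k'_lt) => //=; apply/eqP; rewrite dact_same_eq.
  by rewrite -eqz_mod_dvd -modz_nat modz_mod.
rewrite card_imset ?card_ord // => k l /eqP.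
rewrite dact_same_eq -eqz_mod_dvd !modz_nat !modn_small // => /eqP[]; exact: val_inj.
Qed.

Lemma dorbitE X : dorbit X = rotations X false :|: rotations X true.
Proof.
apply/setP => Y; rewrite inE; apply/imsetP/orP.
  by move=> [[k []] _ ->] /=; [right|left]; apply/imsetP; exists k.
by move=> [] /imsetP[k _ ->]; [exists (k, false)|exists (k, true)].
Qed.

(** Rotated and reflected copies form the same set if [X] has a reflection; otherwise they are
    disjoint, since a common element would give a reflection by [dact_diff_eq]. *)
Lemma card_dorbit X : #|dorbit X| = (minper X * (if achiral X then 1 else 2))%N.
Proof.
rewrite dorbitE; case: achiralP => [[k /reflP hk]|nrefl].
  rewrite (_ : rotations X true = rotations X false) ?setUid ?card_rotations ?muln1 //.
  apply/setP => Y; apply/imsetP/imsetP => -[l _ ->]; apply/imsetP.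
    by apply: (@mem_rotations _ _ (l%:Z - k)) => z; rewrite ind_dact //= -hk; congr ind; ring.
  by apply: (@mem_rotations _ _ (l%:Z + k)) => z; rewrite ind_dact //= -hk; congr ind; ring.
rewrite cardsU !card_rotations (_ : _ :&: _ = set0) ?cards0; first by lia.
apply/setP => Y; rewrite !inE; apply/negP => /andP[/imsetP[k _ ->] /imsetP[l _ /eqP]].
by rewrite dact_diff_eq => h; apply: nrefl; exists (l%:Z - k%:Z).
Qed.

Lemma mem_dorbitP X Y :
  reflect (exists (k : int) (b : bool),
             ind Y =1 (fun z => ind X (if b then k - z else z - k)))
          (Y \in dorbit X).
Proof.
rewrite dorbitE inE; apply: (iffP orP) => [[] /imsetP[k _ ->]|[k [[] h]]].
- by exists (k : nat), false => z; rewrite ind_dact.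
- by exists (k : nat), true => z; rewrite ind_dact.
- by right; exact: (@mem_rotations X true k Y h).
- by left; exact: (@mem_rotations X false k Y h).
Qed.

Lemma dorbit_refl X : X \in dorbit X.
Proof. by apply/mem_dorbitP; exists 0, false => z; rewrite subr0. Qed.

Lemma dorbit_sub X Y Z : Y \in dorbit X -> Z \in dorbit Y -> Z \in dorbit X.
Proof.
move=> /mem_dorbitP[k [b hY]] /mem_dorbitP[l [c hZ]]; apply/mem_dorbitP.
exists (if c then l - k else l + k); exists (b (+) c) => z.
rewrite hZ hY; case: b {hY}; case: c {hZ} => /=; congr ind; ring.
Qed.

Lemma dorbit_sym X Y : Y \in dorbit X -> X \in dorbit Y.
Proof.
move=> /mem_dorbitP[k [b hY]]; apply/mem_dorbitP; exists (if b then k else - k), b => z.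
by rewrite hY; case: b {hY}; congr ind; ring.
Qed.

Lemma dorbit_eq X Y : Y \in dorbit X -> dorbit Y = dorbit X.
Proof.
move=> XY; apply/setP => Z; apply/idP/idP; first exact: dorbit_sub.
by apply: dorbit_sub; apply: dorbit_sym.
Qed.

Lemma dorbit_Xfam X Y : Y \in dorbit X -> X \in Xfam n -> Y \in Xfam n.
Proof.
move=> /mem_dorbitP[k [b hY]] /(XfamP n_gt0) hX; apply/(XfamP n_gt0) => z; rewrite !hY.
case: b {hY}; last by have := hX (z - k); congr (okc (ind X _) _ (ind X _)); ring.
by rewrite okc_sym; have := hX (k - z); congr (okc (ind X _) _ (ind X _)); ring.
Qed.

(** Every orbit has total weight 1 when each element weighs the inverse of the orbit size. Orbit
    counts thus become sums over sets, which can be sorted by minimal period. *)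
Lemma card_orbits (Q : pred {set {set 'I_n}}) :
  (#|[set O in orbits n | Q O]|%:R : rat)
    = \sum_(X in Xfam n | Q (dorbit X)) (#|dorbit X|%:R)^-1.
Proof.
rewrite (partition_big (@dorbit n) (mem [set O in orbits n | Q O])) /=; last first.
  by move=> X /andP[hX hQ]; rewrite inE hQ andbT; apply: imset_f.
rewrite -sum1_card natr_sum; apply: eq_bigr => O; rewrite inE => /andP[/imsetP[X hX ->] hQ].
rewrite (eq_bigl (mem (dorbit X))) => [|Y] /=.
  rewrite (eq_bigr (fun _ => (#|dorbit X|%:R)^-1)) => [|Y /dorbit_eq -> //].
  rewrite big_const iter_addr_0 -[in LHS](mulVf (x := #|dorbit X|%:R)) ?mulr_natr //.
  by rewrite pnatr_eq0 -lt0n; apply/card_gt0P; exists X; exact: dorbit_refl.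
apply/idP/idP => [/andP[_ /eqP <-]|YX]; first exact: dorbit_refl.
by rewrite (dorbit_eq YX) hQ eqxx (dorbit_Xfam YX).
Qed.

End Periods.

(** * Comparing X_n with X_d *)

Section SameIndicator.
Variables (n d : nat) (n_gt0 : (0 < n)%N) (d_gt0 : (0 < d)%N).
Variables (X : {set 'I_n}) (Y : {set 'I_d}) (eXY : ind X =1 ind Y).

Lemma perb_ind k : perb X k = perb Y k.
Proof. by apply/(perP n_gt0)/(perP d_gt0) => h z; move: (h z); rewrite !eXY. Qed.

Lemma reflb_ind k : reflb X k = reflb Y k.
Proof. by apply/(reflP n_gt0)/(reflP d_gt0) => h z; move: (h z); rewrite !eXY. Qed.

Lemma minper_ind : minper X = minper Y.
Proof.
apply/eqP; rewrite eqn_dvd.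
have := perb_ind (minper X); rewrite !perbE // dvdzz => /esym h1.
have := perb_ind (minper Y); rewrite !perbE // dvdzz => h2.
by apply/andP.
Qed.

Lemma achiral_ind : achiral X = achiral Y.
Proof.
by apply/(achiralP n_gt0)/(achiralP d_gt0) => -[k hk]; exists k; move: hk; rewrite reflb_ind.
Qed.

Lemma Xfam_ind : (X \in Xfam n) = (Y \in Xfam d).
Proof. by apply/(XfamP n_gt0)/(XfamP d_gt0) => h z; move: (h z); rewrite !eXY. Qed.

End SameIndicator.

(** * Counting by minimal period and chirality *)

Definition primitive_with (n d : nat) (b : bool) : {set {set 'I_n}} :=
  [set X in Xfam n | (minper X == d) && (achiral X == b)].

Definition nprim (d : nat) (b : bool) : nat := #|primitive_with d d b|.

(** Periodic extension from ['I_d] to ['I_n] and restriction to one period are mutually inverse and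
    keep the indicator, which determines membership, minimal period and chirality. *)
Lemma card_primitive_with n d b : (0 < n)%N -> (d %| n)%N ->
  #|primitive_with n d b| = nprim d b.
Proof.
move=> n_gt0 dn; have d_gt0 := dvdn_gt0 n_gt0 dn.
pose lift (Y : {set 'I_d}) : {set 'I_n} := set_of_fun n (ind Y).
have lift_ind Y : ind (lift Y) =1 ind Y.
  apply: ind_set_of_fun => // z; apply: ind_congr.
  by have /dvdnP[q ->] := dn; rewrite PoszM addrC modzMDl.
have <- : lift @: primitive_with d d b = primitive_with n d b.
  apply/setP => X; apply/imsetP/idP => [[Y hY ->]|].
    move: hY; rewrite !inE -!(in_set (fun X => goodX X)) -/(Xfam _).
    by rewrite (Xfam_ind n_gt0 d_gt0 (lift_ind Y)) (minper_ind n_gt0 d_gt0 (lift_ind Y))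
      (achiral_ind n_gt0 d_gt0 (lift_ind Y)).
  rewrite /primitive_with 2!inE -/(Xfam _) => /andP[hX /andP[/eqP mX aX]].
  pose Y : {set 'I_d} := set_of_fun d (ind X).
  have Y_ind : ind Y =1 ind X.
    by apply: ind_set_of_fun => //; apply/(perP n_gt0); rewrite perbE // mX dvdzz.
  exists Y; last by apply: ind_inj => // z; rewrite lift_ind Y_ind.
  rewrite inE (Xfam_ind d_gt0 n_gt0 Y_ind) inE hX (minper_ind d_gt0 n_gt0 Y_ind) mX eqxx.
  by rewrite (achiral_ind d_gt0 n_gt0 Y_ind).
rewrite card_imset // => Y Z e; apply: ind_inj => // z.
by rewrite -lift_ind e lift_ind.
Qed.

(** Used with three weights: 1 for the size of [Xfam n], the inverse orbit size for [orb], and the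
    number of reflections for the pairs of a set and a reflection. *)
Lemma sum_Xfam n (F : nat -> bool -> rat) : (0 < n)%N ->
  \sum_(X in Xfam n) F (minper X) (achiral X)
    = \sum_(d <- divisors n)
        ((nprim d false)%:R * F d false + (nprim d true)%:R * F d true).
Proof.
move=> n_gt0.
transitivity (\sum_(X in Xfam n) \sum_(d <- divisors n | d == minper X) F d (achiral X)).
  apply: eq_bigr => X _; rewrite -big_filter filter_pred1_uniq ?divisors_uniq ?big_seq1 //.
  by rewrite -dvdn_divisors // minper_dvd.
rewrite (exchange_big_dep predT) //= [LHS]big_seq [RHS]big_seq; apply: eq_bigr => d.
rewrite -dvdn_divisors // => dn.
have part b : (nprim d b)%:R * F d b
    = \sum_(X in Xfam n | (d == minper X) && (achiral X == b)) F d (achiral X).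
  rewrite -(card_primitive_with _ n_gt0) // mulr_natl -sumr_const.
  apply: eq_big => [X|X]; first by rewrite !inE eq_sym.
  by rewrite inE => /andP[_ /andP[_ /eqP ->]].
rewrite !part addrC (bigID (fun X => achiral X)) /=; congr +%R; apply: eq_bigl => X;
  by case: (achiral X); rewrite ?andbT ?andbF.
Qed.

(** For a set of minimal period [d] with reflection [c], the residue class of [c] consists of all
    its reflections. *)
Lemma card_residue n d (c : int) : (0 < n)%N -> (d %| n)%N ->
  #|[set k : 'I_n | (d %| (k : nat)%:Z - c)%Z]| = (n %/ d)%N.
Proof.
move=> n_gt0 dn; have d_gt0 := dvdn_gt0 n_gt0 dn.
have [r cr] := ord_of_int d_gt0 c.
have lt_n (q : 'I_(n %/ d)) : (q * d + r < n)%N.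
  have := ltn_ord q; have := ltn_ord r; have := divnK dn; nia.
have <- : [set Ordinal (lt_n q) | q : 'I_(n %/ d)] = [set k : 'I_n | (d %| (k : nat)%:Z - c)%Z].
  apply/setP => k; rewrite inE -eqz_mod_dvd cr modz_nat eqz_nat.
  apply/imsetP/eqP => [[q _ ->]|kr]; first by rewrite /= modnMDl modn_small.
  have kd : (k %/ d < n %/ d)%N by rewrite ltn_divLR // divnK.
  by exists (Ordinal kd) => //; apply: val_inj; rewrite /= -kr -divn_eq.
rewrite card_imset ?card_ord // => p q [] /addIn /eqP.
by rewrite eqn_pmul2r // => /eqP; exact: val_inj.
Qed.

(* A set with a reflection and minimal period [d] has [n %/ d] reflections. *)
Lemma sum_card_reflb n : (0 < n)%N ->
  ((\sum_(k < n) #|[set X in Xfam n | reflb X (k : nat)]|)%:R : rat)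
    = n%:R * \sum_(d <- divisors n) (nprim d true)%:R / d%:R.
Proof.
move=> n_gt0.
transitivity (\sum_(X in Xfam n) (if achiral X then n%:R / (minper X)%:R else 0) : rat).
  rewrite natr_sum (eq_bigr (fun k : 'I_n => \sum_(X in Xfam n | reflb X (k : nat)) 1));
    last by move=> k _; rewrite -sum1_card natr_sum; apply: eq_bigl => X; rewrite !inE.
  rewrite (exchange_big_dep (mem (Xfam n))) /=; last by move=> k X _ /andP[].
  apply: eq_bigr => X hX; rewrite hX /=; case: (achiralP n_gt0) => [[c hc]|nr].
    rewrite sumr_const (_ : #|_| = (n %/ minper X)%N); last first.
      rewrite -(card_residue c n_gt0) ?minper_dvd //; apply: eq_card => k.
      by rewrite !inE -perbE // -reflb_sub // unfold_in.
    by rewrite natf_div ?minper_dvd.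
  by rewrite big1 // => k hk; case: nr; exists (k : nat).
rewrite (sum_Xfam (fun d b => if b then n%:R / d%:R else 0)) // mulr_sumr.
by apply: eq_bigr => d _; rewrite mulr0 add0r mulrCA.
Qed.

Lemma card_Xfam n : (0 < n)%N ->
  (#|Xfam n|%:R : rat) = \sum_(d <- divisors n) ((nprim d false)%:R + (nprim d true)%:R).
Proof.
move=> n_gt0; rewrite -sum1_card natr_sum (sum_Xfam (fun _ _ => 1)) //.
by apply: eq_bigr => d _; rewrite !mulr1.
Qed.

Lemma orbE n : (0 < n)%N ->
  ((orb n)%:R : rat)
    = \sum_(d <- divisors n) ((nprim d false)%:R / (d * 2)%:R + (nprim d true)%:R / d%:R).
Proof.
move=> n_gt0.
have -> : orb n = #|[set O in orbits n | predT O]|.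
  by rewrite /orb; apply: eq_card => O; rewrite inE andbT.
rewrite card_orbits //.
rewrite (eq_bigr (fun X => ((minper X * (if achiral X then 1 else 2))%:R)^-1));
  last by move=> X _; rewrite card_dorbit.
rewrite (eq_bigl (mem (Xfam n))) => [|X]; last by rewrite /= andbT.
rewrite (sum_Xfam (fun d b => ((d * (if b then 1 else 2))%:R)^-1)) //.
by apply: eq_bigr => d _; rewrite muln1.
Qed.

(** Minimal periods are at most [n], so an orbit of size [2n] requires period [n] and no
    reflection. *)
Lemma orb_1E n : (0 < n)%N -> ((orb_d 1 n)%:R : rat) = (nprim n false)%:R / (n * 2)%:R.
Proof.
move=> n_gt0; rewrite /orb_d card_orbits //.
rewrite (eq_bigr (fun=> (n * 2)%:R^-1)); last first.
  by move=> X /andP[_ /eqP h]; congr (_%:R^-1); lia.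
rewrite sumr_const -[LHS]mulr_natl; congr (_%:R * _); apply: eq_card => X.
rewrite inE unfold_in; congr andb; rewrite card_dorbit //.
have := dvdn_leq n_gt0 (minper_dvd n_gt0 X).
by case: (achiral X); rewrite ?andbF ?andbT //; lia.
Qed.

(** An orbit of size [n] has either period [n] and a reflection, or period [n / 2] and none. Sets of
    the second kind descend to ['I_(n %/ 2)], where [orb_d 1] counts their orbits. *)
Lemma orb_2E n : (0 < n)%N ->
  ((orb_d 2 n)%:R : rat)
    = (nprim n true)%:R / n%:R + (if (2 %| n)%N then (orb_d 1 (n %/ 2))%:R else 0).
Proof.
move=> n_gt0; rewrite /orb_d card_orbits //.
rewrite (eq_bigr (fun=> n%:R^-1)); last first.
  by move=> X /andP[_ /eqP h]; congr (_%:R^-1); lia.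
rewrite (bigID (@achiral n)) /=; congr +%R.
  rewrite sumr_const -[LHS]mulr_natl; congr (_%:R * _); apply: eq_card => X.
  rewrite inE unfold_in -andbA; congr andb; rewrite card_dorbit //.
  by case: (achiral X); rewrite ?andbF ?andbT //; lia.
case: ifP => [n2|n2]; last first.
  rewrite big1 // => X /andP[/andP[_]]; rewrite card_dorbit // => /eqP h /negbTE aX.
  have := minper_dvd n_gt0 X; move: h n2; rewrite aX; lia.
have half_gt0 : (0 < n %/ 2)%N by lia.
rewrite orb_1E // divnK // -(@card_primitive_with n) ?dvdn_div //.
rewrite sumr_const -[LHS]mulr_natl; congr (_%:R * _); apply: eq_card => X.
rewrite inE unfold_in -andbA; congr andb; rewrite card_dorbit //.
by case: (achiral X); rewrite ?andbF ?andbT //; lia.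
Qed.

(** * Counting walks *)

Fixpoint words (m : nat) (a b : bool) : seq (seq bool) :=
  if m is m'.+1 then
    [seq a :: w | w <- (if okc a b true then words m' b true else [::])
                    ++ (if okc a b false then words m' b false else [::])]
  else [:: [:: a; b]].

(** The transfer matrix of [okc] on pairs of consecutive values, raised to the power [m] and applied
    to the indicator vector of [R], at the entry [(a, b)]. *)
Fixpoint walks (R : rel bool) (m : nat) (a b : bool) : nat :=
  (if m is m'.+1 then okc a b true * walks R m' b true + okc a b false * walks R m' b false
   else R a b)%N.

Lemma count_words R m a b :
  count (fun w => R (nth false w m) (nth false w m.+1)) (words m a b) = walks R m a b.
Proof.
elim: m a b => [|m IH] a b /=; first by rewrite addn0.
rewrite count_map count_cat -!IH; congr addn; case: ifP => _; rewrite ?mul1n ?mul0n //;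
  exact: eq_count.
Qed.

Lemma mem_words m a b (w : seq bool) :
  (w \in words m a b) = [&& size w == m.+2, nth false w 0 == a, nth false w 1 == b
    & all (fun i => okc (nth false w i) (nth false w i.+1) (nth false w i.+2)) (iota 0 m)].
Proof.
elim: m a b w => [|m IH] a b w.
  by rewrite /= inE; case: w => [|x [|y [|z w]]] //=; rewrite !eqseq_cons /= ?andbT ?andbF.
apply/idP/idP => [/mapP[v]|].
  rewrite mem_cat => hv ->; rewrite /= eqxx /= (iotaDl 1 0) all_map.
  by case/orP: hv; case: ifP => //; rewrite IH => h /and4P[/eqP -> /eqP -> /eqP -> ok];
    rewrite !eqxx h.
case: w => [|x v] /and4P[sz /eqP /= xa vb]; first by [].
rewrite (iotaDl 1 0) all_map => /andP[h hv]; rewrite xa map_f // mem_cat.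
rewrite xa (eqP vb) in h.
by case e: (nth false v 1) h => h; apply/orP; [left|right]; rewrite h IH e vb eqxx hv !andbT.
Qed.

Lemma uniq_words m a b : uniq (words m a b).
Proof.
elim: m a b => [|m IH] a b //=.
rewrite map_inj_uniq => [|u v [] //]; rewrite cat_uniq.
have uif (c e : bool) : uniq (if c then words m b e else [::]) by case: c.
rewrite !uif andbT /=; apply/hasPn => w; case: ifP => // _; rewrite mem_words.
move=> /and4P[_ _ /eqP h _]; case: ifP => // _; rewrite mem_words h.
by rewrite /= !andbF.
Qed.

(* [Q] is a symmetry condition that makes an element of [Xfam n] determined by its
   values on the window [o, o + m + 1], [z |-> o + g z] being the retraction of
   the integers onto that window and [R] the condition induced by [Q] at its two ends. *)
Lemma card_walks n m (o : int) (Q : pred {set 'I_n}) (R : bool -> bool -> rel bool)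
    (g : int -> nat) :
  (0 < n)%N -> (forall z, (g z < m.+2)%N) ->
  (forall X, X \in Xfam n -> Q X ->
     R (ind X o) (ind X (o + 1)) (ind X (o + m%:Z)) (ind X (o + m.+1%:Z))
     /\ forall z, ind X z = ind X (o + (g z)%:Z)) ->
  (forall y : nat -> bool,
     (forall i, (i < m)%N -> okc (y i) (y i.+1) (y i.+2)) -> R (y 0) (y 1) (y m) (y m.+1) ->
     let f z := y (g z) in
     [/\ forall z, f (z + n%:Z) = f z,
         forall z, okc (f (z - 1)) (f z) (f (z + 1)),
         (forall X, ind X =1 f -> Q X)
       & forall i, (i < m.+2)%N -> f (o + i%:Z) = y i]) ->
  #|[set X in Xfam n | Q X]|
    = (\sum_(ab : bool * bool) walks (R ab.1 ab.2) m ab.1 ab.2)%N.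
Proof.
move=> n_gt0 gm H1 H2.
pose S := [set X in Xfam n | Q X].
pose phi (X : {set 'I_n}) := mkseq (fun i : nat => ind X (o + i%:Z)) m.+2.
pose fin (w : seq bool) := R (nth false w 0) (nth false w 1) (nth false w m) (nth false w m.+1).
pose L := [seq w | ab <- enum ((bool * bool)%type : finType), w <- [seq w <- words m ab.1 ab.2 | fin w]].
have memL w : (w \in L) = [&& size w == m.+2, fin w &
    all (fun i => okc (nth false w i) (nth false w i.+1) (nth false w i.+2)) (iota 0 m)].
  apply/allpairsPdep/and3P => [[ab [v [_ ]]]|[h1 h2 h3]].
    by rewrite mem_filter mem_words => /andP[fv /and4P[sv _ _ av]] ->.
  exists (nth false w 0, nth false w 1), w; split; rewrite ?mem_enum //.
  by rewrite mem_filter h2 mem_words h1 h3 !eqxx.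
have -> : (\sum_(ab : bool * bool) walks (R ab.1 ab.2) m ab.1 ab.2)%N = size L.
  rewrite size_allpairs_dep sumnE big_map big_enum /=; apply: eq_bigr => -[a b] _ /=.
  rewrite size_filter -count_words; apply: eq_in_count => w; rewrite mem_words.
  by move=> /and4P[_ /eqP ea /eqP eb _]; rewrite /fin ea eb.
have uL : uniq L.
  apply: allpairs_uniq_dep => [|ab _|]; first exact: enum_uniq.
    by rewrite filter_uniq ?uniq_words.
  move=> [[a b] v] [[a' b'] v'] /allpairsPdep[x [u [_ hu [-> ->]]]] /allpairsPdep[x' [u' [_ hu' [-> ->]]]] /= e.
  move: hu hu'; rewrite -e !mem_filter !mem_words => /andP[_ /and4P[_ /eqP e1 /eqP e2 _]] /andP[_ /and4P[_ /eqP e3 /eqP e4 _]].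
  by rewrite [x]surjective_pairing [x']surjective_pairing -e1 -e2 -e3 -e4.
have nth_phi X i : (i < m.+2)%N -> nth false (phi X) i = ind X (o + i%:Z).
  exact: nth_mkseq.
(* Reading off the window by [phi] is a bijection from the sets onto the words in [L]: injective by
   [H1], onto by [H2]. *)
rewrite cardE -(size_map phi); apply: perm_size; apply: uniq_perm => //.
  rewrite map_inj_in_uniq ?enum_uniq // => X Y; rewrite !mem_enum !inE -!(in_set (fun X => goodX X)) -/(Xfam n).
  move=> /andP[hX qX] /andP[hY qY] e; apply: ind_inj => // z.
  by rewrite (H1 X hX qX).2 (H1 Y hY qY).2 -!nth_phi // e.
move=> w; rewrite memL; apply/mapP/and3P => [[X]|[/eqP sw fw aw]].
  rewrite mem_enum inE => /andP[hX qX] ->; split; first by rewrite size_mkseq.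
    by rewrite /fin !nth_phi // addr0; have [] := H1 X hX qX.
  apply/allP => i; rewrite mem_iota add0n => im; rewrite !nth_phi; try lia.
  have := (XfamP n_gt0 _ hX) (o + i.+1%:Z); congr (okc (ind X _) _ (ind X _)); lia.
have [|//|per ok qf fy] := H2 (nth false w).
  by move=> i im; apply: (allP aw); rewrite mem_iota.
have indf := @ind_set_of_fun n n_gt0 _ per.
exists (set_of_fun n (fun z => nth false w (g z))).
  rewrite mem_enum inE qf ?andbT //; apply/(XfamP n_gt0) => z; rewrite !indf; exact: ok.
apply: (@eq_from_nth _ false) => [|i]; first by rewrite size_mkseq.
by rewrite sw => im; rewrite nth_phi // indf fy.
Qed.

Lemma walks_false m a b : walks (fun _ _ => false) m a b = 0%N.
Proof. by elim: m a b => //= m IH a b; rewrite !IH !muln0. Qed.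

(* The characteristic polynomial of the transfer matrix on the states 00, 01, 10
   is x^3 - x - 1, whence the Perrin-Padovan recurrence. *)
Lemma walks_rec R m a b : ~~ (a && b) ->
  walks R m.+3 a b = (walks R m.+1 a b + walks R m a b)%N.
Proof. by case: a; case: b => //= _; lia. Qed.

Lemma perrin_ind (P : nat -> Prop) : P 0%N -> P 1%N -> P 2 ->
  (forall m, P m -> P m.+1 -> P m.+3) -> forall m, P m.
Proof.
move=> P0 P1 P2 Prec m; suff [] : [/\ P m, P m.+1 & P m.+2] by [].
by elim: m => [|m [h0 h1 h2]]; split=> //; apply: Prec.
Qed.

(** The trace of a power of the transfer matrix. On the three admissible states alone the identity
    also holds at [m = 0], where [perrin 0] is 3, and [walks_rec] gives the recurrence. *)
Lemma walks_closed m : (0 < m)%N ->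
  (\sum_(ab : bool * bool) walks (fun c d => (c, d) == ab) m ab.1 ab.2)%N = perrin m.
Proof.
move=> m_gt0; rewrite -(pair_bigA _ (fun a b => walks (fun c d => (c, d) == (a, b)) m a b)) /=.
rewrite !big_bool /=.
(* The state [(true, true)] has no successor and would count only for [m = 0]. *)
have -> : walks (fun c d => (c, d) == (true, true)) m true true = 0%N by case: m m_gt0.
rewrite add0n; move: {m_gt0} m; apply: perrin_ind => // m h0 h1.
rewrite !walks_rec // -[RHS]/(perrin m.+1 + perrin m)%N; lia.
Qed.

(** Half-period walks for odd [n]: from an axis through a vertex to an axis through a midpoint. *)
Lemma walks_odd m :
  (walks (fun c d => ~~ c && ~~ d) m false true + walks (fun c d => ~~ c && ~~ d) m true false)%N
    = padovan m.+1.
Proof.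
move: m; apply: perrin_ind => // m h0 h1.
rewrite !walks_rec // -[RHS]/(padovan m.+2 + padovan m.+1)%N; lia.
Qed.

(** Half-period walks for even [n], between two vertices or between two midpoints. Both kinds of
    axes occur equally often, so only the sum of the counts matters. *)
Lemma walks_even m :
  (walks addb m false true + walks addb m true false
    + walks (fun c d => ~~ c && ~~ d) m.+1 false false)%N = (2 * padovan m.+3)%N.
Proof.
move: m; apply: perrin_ind => // m h0 h1.
rewrite !walks_rec // -[padovan m.+4.+2]/(padovan m.+4 + padovan m.+3)%N; lia.
Qed.

(** * Perrin and Padovan counts *)

Lemma card_Xfam_perrin n : (0 < n)%N -> #|Xfam n| = perrin n.
Proof.
move=> n_gt0.
have -> : #|Xfam n| = #|[set X in Xfam n | predT X]|.
  by apply: eq_card => X; rewrite inE andbT.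
have absK (z : int) : (`|(z %% n)%Z|%N : int) = (z %% n)%Z by lia.
rewrite (@card_walks n n 0 predT (fun a b c d => (c, d) == (a, b)) (fun z => `|(z %% n)%Z|%N)).
- by rewrite -walks_closed //; apply: eq_bigr => -[].
- done.
- by move=> z; have := ltz_pmod z (n_gt0 : 0 < n%:Z); lia.
- move=> X _ _; rewrite !add0r; split.
    apply/eqP; congr pair; apply: ind_congr; first by rewrite modzz mod0z.
    by rewrite intS addrC modzDl.
  by move=> z; rewrite add0r absK ind_mod.
move=> y oky /eqP[y0 y1] f.
have f_congr x z : (x = z %[mod n])%Z -> f x = f z by rewrite /f => ->.
have f_nat (i : nat) : (i < n.+2)%N -> f i = y i.
  rewrite /f modz_nat absz_nat.
  rewrite !ltnS leq_eqVlt ltnS leq_eqVlt => /or3P[/eqP->|/eqP->|i_lt]; last by rewrite modn_small.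
    (* For [n = 1] the position [n + 1] reduces to 0 instead of 1, and both closing equations are
       needed. *)
    case: n n_gt0 y0 y1 {oky f f_congr absK} => // -[|n] _ y0 y1.
      by rewrite modn1 y1 y0.
    by rewrite -addn1 modnDl modn_small // addn1 y1.
  by rewrite modnn y0.
split=> // z.
- by apply: f_congr; rewrite modzDr.
- have [c zc] := ord_of_int n_gt0 (z - 1).
  have c_lt := ltn_ord c.
  have zc' : (z - 1 = c%:Z %[mod n])%Z by rewrite -zc modz_mod.
  have -> : f (z - 1) = y c by rewrite -f_nat; [exact: f_congr | lia].
  have -> : f z = y c.+1.
    rewrite -f_nat; last by lia.
    by apply: f_congr; rewrite -(subrK 1 z) -modzDml zc' modzDml intS addrC.
  have -> : f (z + 1) = y c.+2.
    rewrite -f_nat; last by lia.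
    by apply: f_congr; rewrite -(subrK 1 z) -addrA -modzDml zc' modzDml -addn2 PoszD.
  by apply: oky.
Qed.

(* The representative of [z] in the fundamental domain [0, (n - e)/2] of the group
   generated by the translation by [n] and the reflection [z |-> - e - z]. *)
Definition fold (e : bool) (n : nat) (z : int) : nat :=
  minn `|(z %% n)%Z| `|((- e%:Z - z) %% n)%Z|.

Section Fold.
Variables (e : bool) (n : nat) (n_gt0 : (0 < n)%N).

Lemma fold_congr x z : (x = z %[mod n])%Z -> fold e n x = fold e n z.
Proof.
by move=> xz; rewrite /fold xz -[in LHS]modzDmr -modzNm xz modzNm modzDmr.
Qed.

Lemma fold_refl z : fold e n (- e%:Z - z) = fold e n z.
Proof. by rewrite /fold minnC; congr (minn `|(_ %% _)%Z| _); ring. Qed.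

Lemma foldP z : (z = fold e n z %[mod n])%Z \/ (- e%:Z - z = fold e n z %[mod n])%Z.
Proof.
have absK (x : int) : (`|(x %% n)%Z|%N : int) = (x %% n)%Z by lia.
by rewrite /fold /minn; case: ifP => _; rewrite absK modz_mod; [left|right].
Qed.

(** The exception is the fixed point 0 of [z |-> - z], for which [n - e - r] would be [n] and not
    reduced. *)
Lemma modz_refl (r : nat) : (r < n)%N ->
  ((- e%:Z - r%:Z) %% n)%Z = (if ~~ e && (r == 0%N) then 0 else n - e - r)%N.
Proof.
move=> r_lt; case: ifP => [/andP[/negbTE -> /eqP ->]|h]; first by rewrite subr0 oppr0 mod0z.
have -> : ((- e%:Z - r%:Z) %% n)%Z = ((n - e - r)%N %% n)%Z.
  by rewrite -[LHS]modzDl; congr modz; move: h; case: e; lia.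
by rewrite modz_small //; move: h; case: e; lia.
Qed.

Lemma fold_le z : (2 * fold e n z <= n - e)%N.
Proof.
rewrite -(@fold_congr (z %% n)%Z) ?modz_mod //; have [r ->] := ord_of_int n_gt0 z.
rewrite /fold modz_refl // modz_nat modn_small //.
by have := ltn_ord r; case: ifP; lia.
Qed.

Lemma fold_small (i : nat) : (2 * i <= n - e)%N -> fold e n i = i.
Proof.
move=> i_le; rewrite /fold.
have i_lt : (i < n)%N by case: (e) i_le; lia.
rewrite modz_refl // modz_nat modn_small //.
by case: ifP; lia.
Qed.

Lemma ind_fold (X : {set 'I_n}) z : reflb X (- e%:Z) -> ind X z = ind X (fold e n z).
Proof.
move=> /(reflP n_gt0) rX; have [h|h] := foldP z; first exact: ind_congr.
by rewrite -rX; apply: ind_congr.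
Qed.

(** Translations preserve [okc] and reflections reverse its arguments, so checking it on the
    fundamental domain is enough. *)
Lemma okc_fold (f : int -> bool) :
  (forall x z, (x = z %[mod n])%Z -> f x = f z) ->
  (forall z, f (- e%:Z - z) = f z) ->
  (forall c : nat, (2 * c <= n - e)%N -> okc (f (c%:Z - 1)) (f c) (f (c%:Z + 1))) ->
  forall z, okc (f (z - 1)) (f z) (f (z + 1)).
Proof.
move=> fC fR ok z; have okf := ok _ (fold_le z).
have [h|h] := foldP z.
  have -> : f (z - 1) = f ((fold e n z)%:Z - 1) by apply: fC; rewrite -[LHS]modzDml h modzDml.
  have -> : f (z + 1) = f ((fold e n z)%:Z + 1) by apply: fC; rewrite -[LHS]modzDml h modzDml.
  by rewrite (fC _ _ h).
rewrite okc_sym -(fR z) -(fR (z - 1)) -(fR (z + 1)) (fC _ _ h).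
have -> : f (- e%:Z - (z + 1)) = f ((fold e n z)%:Z - 1).
  by apply: fC; rewrite opprD addrA -[LHS]modzDml h modzDml.
suff -> : f (- e%:Z - (z - 1)) = f ((fold e n z)%:Z + 1) by [].
by apply: fC; rewrite opprB addrCA addrC -[LHS]modzDml h modzDml.
Qed.

End Fold.

Definition nrefl (n : nat) (k : int) : nat := #|[set X in Xfam n | reflb X k]|.

(* In the three cases below the half period is read as a walk between the axes.
   At an axis through a vertex [c], [f (c - 1) = f (c + 1)] forces
   [f c != f (c + 1)]; at an axis through the midpoint of [c, c + 1],
   [f c = f (c + 1)] forces both to vanish. *)
Lemma nrefl_odd m : nrefl m.*2.+1 0 = padovan m.+1.
Proof.
set n := m.*2.+1; have n_gt0 : (0 < n)%N by [].
rewrite /nrefl (@card_walks n m 0 (fun X => reflb X 0)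
  (fun a b c d => (a (+) b) && (~~ c && ~~ d)) (fold false n)) //.
- rewrite -walks_odd -(pair_bigA _ (fun a b => walks (fun c d => (a (+) b) && (~~ c && ~~ d)) m a b)).
  by rewrite !big_bool /= !walks_false add0n addn0 addnC.
- by move=> z; have := fold_le false n_gt0 z; rewrite /n; lia.
- move=> X /(XfamP n_gt0) okX rX; split; last by move=> z; rewrite add0r; apply: (@ind_fold false).
  have sym := reflP n_gt0 _ _ rX.
  (* The second axis of [z |-> - z] modulo [2m + 1] is the midpoint of [[m, m + 1]]. *)
  have e1 : ind X (m.+1 : int) = ind X (m : int).
    rewrite -sym -ind_addn; congr ind; rewrite /n; lia.
  have := okX 0; have := okX (m : int); rewrite !add0r !e1 -[ind X (- 1)]sym opprK.
  rewrite (_ : m%:Z + 1 = m.+1 :> int) ?e1; last by lia.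
  by case: (ind X 0); case: (ind X 1); case: (ind X m); case: (ind X (m%:Z - 1)).
move=> y oky /andP[y01 /andP[ym ym1]] f.
have fC x z : (x = z %[mod n])%Z -> f x = f z by move=> h; rewrite /f (fold_congr _ h).
have fR z : f (0 - z) = f z by rewrite /f (fold_refl false).
have f_nat (i : nat) : (i < m.+2)%N -> f i = y i.
  move=> im; have [i_le|i_gt] := leqP (2 * i) (n - false).
    by rewrite /f fold_small.
  (* Position [m + 1] folds to [m], and the end condition makes both values false. *)
  have -> : i = m.+1 by rewrite /n in i_gt; lia.
  rewrite -fR (fC _ (m : int)); first by rewrite /f fold_small ?(negbTE ym) ?(negbTE ym1) // /n; lia.
  by rewrite -[LHS]modzDr; congr modz; rewrite /n; lia.
split=> [z||X eX|i im]; last by rewrite add0r f_nat.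
- by apply: fC; rewrite modzDr.
- apply: (@okc_fold false n) => // -[|c] c_le.
    have -> : f (0%:Z - 1) = y 1 by rewrite -fR (_ : 0 - (0%:Z - 1) = 1%N) ?f_nat.
    have -> : f (0%:Z + 1) = y 1 by rewrite add0r f_nat.
    rewrite f_nat //; by move: y01; case: (y 0); case: (y 1).
  have -> : c.+1%:Z - 1 = c%:Z by lia.
  have -> : c.+1%:Z + 1 = c.+2%:Z by lia.
  have c_lt : (c < m)%N by rewrite /n in c_le; lia.
  rewrite !f_nat; [exact: oky | lia | lia | lia].
by apply/(reflP n_gt0) => z; rewrite !eX fR.
Qed.

Lemma nrefl_vertex m : nrefl m.+1.*2 0 = (walks addb m false true + walks addb m true false)%N.
Proof.
set n := m.+1.*2; have n_gt0 : (0 < n)%N by [].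
rewrite /nrefl (@card_walks n m 0 (fun X => reflb X 0)
  (fun a b c d => (a (+) b) && (c (+) d)) (fold false n)) //.
- rewrite -(pair_bigA _ (fun a b => walks (fun c d => (a (+) b) && (c (+) d)) m a b)).
  by rewrite !big_bool /= !walks_false add0n addn0 addnC.
- by move=> z; have := fold_le false n_gt0 z; rewrite /n; lia.
- move=> X /(XfamP n_gt0) okX rX; split; last by move=> z; rewrite add0r; apply: (@ind_fold false).
  have sym := reflP n_gt0 _ _ rX.
  (* The second axis passes through the vertex [m + 1], whose neighbours are [m] and [m + 2]. *)
  have e1 : ind X (m.+2 : int) = ind X (m : int).
    rewrite -sym -ind_addn; congr ind; rewrite /n; lia.
  have := okX 0; have := okX (m.+1 : int); rewrite !add0r -[ind X (- 1)]sym opprK.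
  rewrite (_ : m.+1%:Z + 1 = m.+2 :> int) ?e1; last by lia.
  rewrite (_ : m.+1%:Z - 1 = m :> int); last by lia.
  by case: (ind X 0); case: (ind X 1); case: (ind X m); case: (ind X m.+1).
move=> y oky /andP[y01 ym] f.
have fC x z : (x = z %[mod n])%Z -> f x = f z by move=> h; rewrite /f (fold_congr _ h).
have fR z : f (0 - z) = f z by rewrite /f (fold_refl false).
have f_nat (i : nat) : (i < m.+2)%N -> f i = y i.
  by move=> im; rewrite /f fold_small // /n; lia.
split=> [z||X eX|i im]; last by rewrite add0r f_nat.
- by apply: fC; rewrite modzDr.
- apply: (@okc_fold false n) => // -[|c] c_le.
    have -> : f (0%:Z - 1) = y 1 by rewrite -fR (_ : 0 - (0%:Z - 1) = 1%N) ?f_nat.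
    have -> : f (0%:Z + 1) = y 1 by rewrite add0r f_nat.
    rewrite f_nat //; by move: y01; case: (y 0); case: (y 1).
  have -> : c.+1%:Z - 1 = c%:Z by lia.
  have -> : c.+1%:Z + 1 = c.+2%:Z by lia.
  have c_le' : (c <= m)%N by rewrite /n in c_le; lia.
  (* At [c = m] the triple is centred on the second axis and reaches beyond the window; it is
     admissible because [y m] and [y m.+1] differ. *)
  move: c_le'; rewrite leq_eqVlt => /orP[/eqP ->|c_lt].
    have -> : f m.+2 = f m.
      by rewrite -fR; apply: fC; rewrite -[LHS]modzDr; congr modz; rewrite /n; lia.
    by rewrite !f_nat //; move: ym; case: (y m); case: (y m.+1).
  by rewrite !f_nat ?oky //; lia.
by apply/(reflP n_gt0) => z; rewrite !eX fR.
Qed.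

Lemma nrefl_edge m :
  nrefl m.+1.*2 (- 1) = walks (fun c d => ~~ c && ~~ d) m.+1 false false.
Proof.
set n := m.+1.*2; have n_gt0 : (0 < n)%N by [].
(* The window starts at [-1], one place before the fundamental domain [[0, m]], so that its first
   pair straddles the axis; hence the successor of [fold] and the extra step. *)
rewrite /nrefl (@card_walks n m.+1 (-1) (fun X => reflb X (- 1))
  (fun a b c d => (~~ a && ~~ b) && (~~ c && ~~ d)) (fun z => (fold true n z).+1)) //.
- rewrite -(pair_bigA _ (fun a b => walks (fun c d => (~~ a && ~~ b) && (~~ c && ~~ d)) m.+1 a b)).
  by rewrite !big_bool /= !walks_false !muln0 !add0n.
- by move=> z; have := fold_le true n_gt0 z; rewrite /n; lia.
- move=> X /(XfamP n_gt0) okX rX; split; last first.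
    move=> z; rewrite (_ : -1 + _ = (fold true n z)%:Z); last by lia.
    exact: (@ind_fold true).
  have sym := reflP n_gt0 _ _ rX.
  have e1 : ind X (m.+1 : int) = ind X (m : int).
    rewrite -sym -ind_addn; congr ind; rewrite /n; lia.
  have := okX 0; have := okX (m : int); rewrite !add0r addNr -[ind X (- 1)]sym opprK addNr.
  have -> : -1 + m.+1%:Z = m%:Z by lia.
  have -> : -1 + m.+2%:Z = m.+1%:Z by lia.
  have -> : m%:Z + 1 = m.+1%:Z by lia.
  rewrite !e1.
  by case: (ind X 0); case: (ind X 1); case: (ind X m); case: (ind X (m%:Z - 1)).
move=> y oky /andP[/andP[y0 y1] /andP[ym ym1]] f.
have fC x z : (x = z %[mod n])%Z -> f x = f z by move=> h; rewrite /f (fold_congr _ h).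
have fR z : f (- 1 - z) = f z by rewrite /f (fold_refl true).
have f_nat (i : nat) : (i < m.+2)%N -> f i = y i.+1.
  move=> im; have [i_le|i_gt] := leqP (2 * i) (n - true).
    by rewrite /f fold_small.
  have -> : i = m.+1 by rewrite /n in i_gt; lia.
  rewrite -fR (fC _ (m : int)); first by rewrite /f fold_small ?(negbTE ym) ?(negbTE ym1) // /n; lia.
  by rewrite -[LHS]modzDr; congr modz; rewrite /n; lia.
have f_m1 : f (- 1) = y 0 by rewrite -fR subrr f_nat // (negbTE y0) (negbTE y1).
split=> [z||X eX|[|i] im].
- by apply: fC; rewrite modzDr.
- apply: (@okc_fold true n) => // -[|c] c_le.
    by rewrite !add0r f_m1 !f_nat //; apply: oky.
  have -> : c.+1%:Z - 1 = c%:Z by lia.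
  have -> : c.+1%:Z + 1 = c.+2%:Z by lia.
  have c_lt : (c < m)%N by rewrite /n in c_le; lia.
  rewrite !f_nat; [apply: oky; lia | lia | lia | lia].
- by apply/(reflP n_gt0) => z; rewrite !eX fR.
- by rewrite addr0.
- by rewrite (_ : -1 + i.+1%:Z = i%:Z); [rewrite f_nat | lia].
Qed.

(** Translating a set by [t] moves the parameter of a reflection by [2t]. This gives one inequality,
    and [- t] gives the other; the count depends only on the parity of [k]. *)
Lemma nrefl_shift n (k t : int) : (0 < n)%N -> nrefl n (k + t *+ 2) = nrefl n k.
Proof.
move=> n_gt0.
have le_shift a s : (nrefl n a <= nrefl n (a + s *+ 2))%N.
  pose h (X : {set 'I_n}) : {set 'I_n} := set_of_fun n (fun z => ind X (z - s)).
  have h_ind X : ind (h X) =1 (fun z => ind X (z - s)).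
    by apply: ind_set_of_fun => // z; rewrite addrAC ind_addn.
  rewrite /nrefl -(card_imset (f := h)); last first.
    move=> X Y e; apply: ind_inj => // z.
    by rewrite -(addrK s z) -!h_ind e.
  apply/subset_leq_card/subsetP => _ /imsetP[X + ->].
  rewrite !inE -!(in_set (fun X => goodX X)) -/(Xfam n) => /andP[/(XfamP n_gt0) okX /(reflP n_gt0) rX].
  apply/andP; split.
    by apply/(XfamP n_gt0) => z; rewrite !h_ind addrAC (addrAC z 1).
  by apply/(reflP n_gt0) => z; rewrite !h_ind -[RHS]rX; congr ind; ring.
apply/eqP; rewrite eqn_leq le_shift andbT.
by have := le_shift (k + t *+ 2) (- t); rewrite mulNrn addrK.
Qed.

Lemma nrefl_addn n k : (0 < n)%N -> nrefl n (k + n%:Z) = nrefl n k.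
Proof.
move=> n_gt0; apply: eq_card => X; rewrite !inE; congr andb.
apply/(reflP n_gt0)/(reflP n_gt0) => h z; last by rewrite addrAC ind_addn h.
by rewrite -[RHS]h addrAC ind_addn.
Qed.

(** For odd [n], adding [n] changes the parity of the parameter, so all axes count alike. For even
    [n], half of the parameters are even and half odd, and the two classes average to [rr n]. *)
Lemma sum_nrefl n : (0 < n)%N -> (\sum_(k < n) nrefl n (k : nat) = n * rr n)%N.
Proof.
move=> n_gt0; rewrite /rr; case: ifP => n_odd.
  have [m en] : exists m, n = m.*2.+1 by exists n./2; rewrite -[LHS]odd_double_half n_odd.
  rewrite (eq_bigr (fun=> padovan m.+1)) => [|k _].
    rewrite sum_nat_const card_ord; congr muln; congr padovan; lia.
  rewrite -nrefl_odd -en; case ek: (odd k).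
    rewrite -[RHS]nrefl_addn // -[RHS](@nrefl_shift _ _ ((k : nat)./2%:Z - m%:Z)) //.
    by congr nrefl; lia.
  by rewrite -[RHS](@nrefl_shift _ _ (k : nat)./2%:Z) //; congr nrefl; lia.
have [m en] : exists m, n = m.+1.*2 by exists n./2.-1; lia.
have half q : (\sum_(k < q.*2) nrefl n (k : nat) = q * (nrefl n 0 + nrefl n (- 1)))%N.
  elim: q => [|q IH]; first by rewrite big_ord0.
  rewrite doubleS !big_ord_recr /= IH mulSn [RHS]addnC -addnA; congr (_ + (_ + _))%N.
    by rewrite -(@nrefl_shift _ 0 q) //; congr nrefl; lia.
  by rewrite -(@nrefl_shift _ (- 1) q.+1) //; congr nrefl; lia.
rewrite [in LHS]en -[in X in nrefl X]en half en nrefl_vertex nrefl_edge walks_even.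
rewrite (_ : (m.+1.*2./2 + 2)%N = m.+3); lia.
Qed.

(** * Moebius inversion *)

Lemma moebius_primeM p e : prime p -> (0 < e)%N ->
  moebius (p * e) = if (p %| e)%N then 0 else - moebius e.
Proof.
move=> p_pr e_gt0; have p_gt0 := prime_gt0 p_pr.
rewrite /moebius muln_eq0 !gtn_eqF //=; case: (boolP (p %| e)%N) => pe.
  case: allP => // h; have := h p; rewrite mem_primes p_pr muln_gt0 p_gt0 e_gt0 dvdn_mulr //.
  rewrite lognM // logn_prime // eqxx => /(_ isT); rewrite eqSS.
  by rewrite -leqn0 leqNgt logn_gt0 mem_primes p_pr e_gt0 pe.
have pN : p \notin primes e by rewrite mem_primes (negbTE pe) !andbF.
have perm_pe : perm_eq (primes (p * e)) (p :: primes e).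
  apply: uniq_perm; rewrite /= ?primes_uniq ?pN // => q.
  by rewrite primesM // primes_prime // inE.
rewrite (perm_size perm_pe) (perm_all _ perm_pe) /=.
rewrite lognM // logn_prime // eqxx (lognE p e) (negbTE pe) !andbF /=.
rewrite (eq_in_all (a2 := fun q => logn q e == 1%N)) => [|q qe].
  by case: ifP; rewrite ?oppr0 // exprS mulN1r.
have /negbTE qp : q != p by apply: contraNneq pN => <-.
by rewrite lognM // logn_prime // qp.
Qed.

(** For [p = pdiv n] and [n = p m], a divisor [p e] contributes [- moebius e] if [p] does not divide
    [e] and 0 otherwise. This cancels the divisors prime to [p], which all divide [m]. *)
Lemma sum_moebius n : (0 < n)%N -> \sum_(d <- divisors n) moebius d = (n == 1%N)%:R.
Proof.
move=> n_gt0; have [->|n_neq1] := eqVneq n 1%N; first by rewrite big_seq1.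
have p_pr : prime (pdiv n) by rewrite pdiv_prime //; lia.
have [m en] : exists m, n = (pdiv n * m)%N.
  by exists (n %/ pdiv n)%N; rewrite mulnC divnK ?pdiv_dvd.
move: (pdiv n) p_pr en => p p_pr en; have p_gt0 := prime_gt0 p_pr.
have m_gt0 : (0 < m)%N by lia.
rewrite (bigID (fun d => p %| d)%N) /= -big_filter -[X in _ + X]big_filter.
rewrite (perm_big [seq (p * e)%N | e <- divisors m]) /=; last first.
  apply: uniq_perm; rewrite ?filter_uniq ?divisors_uniq //.
    rewrite map_inj_uniq ?divisors_uniq // => a b /eqP.
    by rewrite eqn_pmul2l // => /eqP.
  move=> d; rewrite mem_filter -dvdn_divisors //.
  apply/andP/mapP => [[/dvdnP[e ->] h]|[e]].
    exists e; last by rewrite mulnC.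
    by move: h; rewrite en (mulnC e) dvdn_pmul2l // dvdn_divisors.
  by rewrite -dvdn_divisors // => h ->; split; [rewrite dvdn_mulr | rewrite en dvdn_pmul2l].
rewrite big_map [X in _ + X](perm_big [seq d <- divisors m | ~~ (p %| d)%N]) /=; last first.
  apply: uniq_perm; rewrite ?filter_uniq ?divisors_uniq // => d.
  rewrite !mem_filter -!dvdn_divisors //; case: (boolP (p %| d)%N) => //= pd.
  by rewrite en Gauss_dvdr // coprime_sym prime_coprime.
rewrite [X in X + _]big_seq [X in X + _](eq_bigr (fun e => if (p %| e)%N then 0 else - moebius e));
  last by move=> e; rewrite -dvdn_divisors // => /dvdn_gt0 e_gt0; rewrite moebius_primeM // e_gt0.
rewrite -[X in X + _]big_seq big_filter (bigID (fun d => p %| d)%N) /= big1 => [|d ->//].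
rewrite add0r (eq_bigr (fun d => - moebius d)) => [|d /negbTE ->//].
by rewrite sumrN addNr.
Qed.

Lemma moebius_inversion (f g : nat -> rat) :
  (forall n, (0 < n)%N -> g n = \sum_(d <- divisors n) f d) ->
  forall n, (0 < n)%N -> \sum_(d <- divisors n) g d * (moebius (n %/ d))%:~R = f n.
Proof.
move=> gE n n_gt0.
transitivity (\sum_(d <- divisors n) \sum_(e <- divisors n | (e %| d)%N)
                f e * (moebius (n %/ d))%:~R).
  rewrite big_seq [RHS]big_seq; apply: eq_bigr => d; rewrite -dvdn_divisors // => dn.
  have d_gt0 := dvdn_gt0 n_gt0 dn.
  rewrite gE // mulr_suml -[RHS]big_filter; apply: perm_big.
  apply: uniq_perm; rewrite ?filter_uniq ?divisors_uniq // => e.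
  rewrite mem_filter -!dvdn_divisors //; case: (boolP (e %| d)%N) => //= ed.
  by rewrite (dvdn_trans ed).
rewrite (exchange_big_dep predT) //=.
transitivity (\sum_(e <- divisors n | e == n) f e); last first.
  rewrite -big_filter filter_pred1_uniq ?divisors_uniq ?big_seq1 //.
  by rewrite -dvdn_divisors.
rewrite [RHS]big_mkcond big_seq [RHS]big_seq; apply: eq_bigr => e; rewrite -dvdn_divisors // => en.
have e_gt0 := dvdn_gt0 n_gt0 en; have q_gt0 : (0 < n %/ e)%N by rewrite divn_gt0 // dvdn_leq.
(* The multiples [d] of [e] dividing [n] are the [n / c] with [c] dividing [n / e], which turns the
   inner sum into that of [sum_moebius]. *)
rewrite -mulr_sumr -big_filter (perm_big [seq (n %/ c)%N | c <- divisors (n %/ e)]) /=; last first.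
  apply: uniq_perm; rewrite ?filter_uniq ?divisors_uniq //.
    rewrite map_inj_in_uniq ?divisors_uniq // => a b; rewrite -!dvdn_divisors // => ha hb ab.
    have an : (a %| n)%N by apply: dvdn_trans ha _; rewrite dvdn_div.
    have bn : (b %| n)%N by apply: dvdn_trans hb _; rewrite dvdn_div.
    have q_gt0' : (0 < n %/ a)%N by rewrite divn_gt0 ?(dvdn_gt0 n_gt0 an) // dvdn_leq.
    have /eqP : (n %/ a * a = n %/ a * b)%N by rewrite (divnK an) ab (divnK bn).
    by rewrite eqn_pmul2l // => /eqP.
  move=> d; rewrite mem_filter -dvdn_divisors //; apply/andP/mapP => [[ed dn]|[c]].
    have d_gt0 := dvdn_gt0 n_gt0 dn.
    case/dvdnP: ed dn d_gt0 => l -> /dvdnP[k nE] le_gt0.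
    exists k; last by rewrite nE mulKn //; lia.
    by rewrite -dvdn_divisors // nE mulnA mulnK // dvdn_mulr.
  rewrite -dvdn_divisors // => /dvdnP[k kE] ->.
  have nE : n = (k * e * c)%N by rewrite -(divnK en) kE mulnAC.
  have c_gt0 : (0 < c)%N by lia.
  by rewrite nE mulnK // dvdn_mull // dvdn_mulr.
rewrite big_map [X in _ * X]big_seq (eq_bigr (fun c => (moebius c)%:~R)) => [|c].
  rewrite -big_seq -mulrz_sumr sum_moebius //.
  have -> : (n %/ e == 1)%N = (e == n) by rewrite eq_sym eqn_div // mul1n.
  by case: eqP; rewrite ?mulr1 ?mulr0.
rewrite -dvdn_divisors // => cq.
have cn : (c %| n)%N by apply: dvdn_trans cq _; rewrite dvdn_div.
by rewrite divnA // mulKn.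
Qed.

(** Double counting of the pairs of a set and a reflection: by sets in [sum_card_reflb], by
    reflections in [sum_nrefl]. *)
Lemma rrE n : (0 < n)%N ->
  ((rr n)%:R : rat) = \sum_(d <- divisors n) (nprim d true)%:R / d%:R.
Proof.
move=> n_gt0; apply: (mulfI (x := n%:R)); first by rewrite pnatr_eq0 -lt0n.
by rewrite -sum_card_reflb // -natrM -sum_nrefl.
Qed.

Lemma perrinE n : (0 < n)%N ->
  ((perrin n)%:R : rat)
    = \sum_(d <- divisors n) ((nprim d false)%:R + (nprim d true)%:R).
Proof. by move=> n_gt0; rewrite -card_Xfam_perrin // card_Xfam. Qed.

Unset Implicit Arguments.
Local Close Scope ring_scope.

Theorem theorem3p1 (n : nat) (hn : 0 < n) :
  [/\ orb n = rr n + \sum_(d <- divisors n) orb_d 1 d,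
      ((2 * orb_d 1 n)%:R : rat)
        = ((n%:R)^-1 * (\sum_(d <- divisors n) (perrin d)%:R * (moebius (n %/ d))%:~R)
          - \sum_(d <- divisors n) (rr d)%:R * (moebius (n %/ d))%:~R)%R
    & ((orb_d 2 n)%:Z : int)
        = ((\sum_(d <- divisors n) (rr d)%:Z * moebius (n %/ d))
          + (if (2 %| n)%N then (orb_d 1 (n %/ 2))%:Z else 0))%R].
Proof.
have rr_mu := @moebius_inversion (fun d => (nprim d true)%:R / d%:R)%R (fun d => (rr d)%:R)%R rrE n hn.
have perrin_mu := @moebius_inversion (fun d => (nprim d false)%:R + (nprim d true)%:R)%R
  (fun d => (perrin d)%:R)%R perrinE n hn.
have n_neq0 : (n%:R != 0 :> rat)%R by rewrite pnatr_eq0 -lt0n.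
split.
- apply/eqP; rewrite -(eqr_nat rat) natrD natr_sum orbE // rrE // addrC big_split /=.
  apply/eqP; congr (_ + _)%R; rewrite big_seq [RHS]big_seq; apply: eq_bigr => d.
  by rewrite -dvdn_divisors // => /(dvdn_gt0 hn) d_gt0; rewrite orb_1E.
- rewrite rr_mu perrin_mu natrM orb_1E // natrM.
  by field.
(* The inversion formula lives in [rat], so the integer identity is compared there. *)
- apply: (@intr_inj rat); rewrite rmorphD rmorph_sum /= -pmulrn orb_2E // -rr_mu; congr (_ + _)%R.
    by apply: eq_bigr => d _; rewrite rmorphM /= -pmulrn.
  by case: ifP => // _; rewrite -pmulrn.
Qed.
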